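(* Let $M\in\mathbb{C}(x)^{p\times p}$ be invertible, $\mathcal{A}\in\mathbb{C}(x)^{m\times n\times p}$ and $\mathcal{W}\in\mathbb{C}(x)^{n\times m\times p}$, with $\mathrm{rank}_M(\mathcal{A})=(r,r,\ldots,r)$ and $\mathrm{rank}_M(\mathcal{W})=(s,s,\ldots,s)$, $s\le r$. Let $\mathcal{W}=\mathcal{Q}*_M\mathcal{D}*_M\mathcal{R}$ be an $M$-$\mathcal{QDR}$ decomposition of $\mathcal{W}$, where $\mathcal{Q}\in\mathbb{C}(x)^{n\times s\times p}$, $\mathcal{D}\in\mathbb{C}(x)^{s\times s\times p}$ and $\mathcal{R}\in\mathbb{C}(x)^{s\times m\times p}$. If $\mathrm{rank}_M(\mathcal{R}*_M\mathcal{A}*_M\mathcal{Q})=\mathrm{rank}_M(\mathcal{W})$ and $\mathcal{A}^{(2)}_{\mathscr{R}(\mathcal{W}),\mathscr{N}(\mathcal{W})}$ exists, then $$\mathcal{A}^{(2)}_{\mathscr{R}(\mathcal{W}),\mathscr{N}(\mathcal{W})}=\mathcal{Q}*_M(\mathcal{R}*_M\mathcal{A}*_M\mathcal{Q})^{-1}*_M\mathcal{R}=\mathcal{A}^{(2)}_{\mathscr{R}(\mathcal{Q}),\mathscr{N}(\mathcal{R})}.$$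
   Context: $\mathbb{C}(x)$ is the field of rational functions in $x$ over $\mathbb{C}$, and $\mathbb{C}(x)^{m\times n\times p}$ the set of third-order tensors over it. For $\mathcal{A}\in\mathbb{C}(x)^{m\times n\times p}$ and an invertible $M\in\mathbb{C}(x)^{p\times p}$, let $\tilde{\mathcal{A}}=\mathcal{A}\times_3 M$, i.e. $\tilde{\mathcal{A}}(i,j,k)=\sum_{l=1}^p M(k,l)\,\mathcal{A}(i,j,l)$; its $k$-th frontal slice is the matrix $\tilde{\mathcal{A}}(:,:,k)$. M-product: for $\mathcal{A}\in\mathbb{C}(x)^{m\times n\times p}$ and $\mathcal{B}\in\mathbb{C}(x)^{n\times q\times p}$, $\mathcal{A}*_M\mathcal{B}\in\mathbb{C}(x)^{m\times q\times p}$ is the unique tensor $\mathcal{C}$ with $\tilde{\mathcal{C}}(:,:,k)=\tilde{\mathcal{A}}(:,:,k)\tilde{\mathcal{B}}(:,:,k)$ for all $k=1,\ldots,p$. A tensor $\mathcal{A}\in\mathbb{C}(x)^{n\times n\times p}$ is invertible if every frontal slice of $\tilde{\mathcal{A}}$ is invertible over $\mathbb{C}(x)$; then $\widetilde{\mathcal{A}^{-1}}(:,:,k)=(\tilde{\mathcal{A}}(:,:,k))^{-1}$. Multirank: $\mathrm{rank}_M(\mathcal{A})=(r_1,\ldots,r_p)$ with $r_k=\mathrm{rank}(\tilde{\mathcal{A}}(:,:,k))$ (rank over $\mathbb{C}(x)$). Tubal rank: $\mathrm{rank}_t(\mathcal{A})=\max_k r_k$. $M$-$\mathcal{QDR}$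 decomposition: for $\mathcal{A}\in\mathbb{C}(x)^{m\times n\times p}$ with $\mathrm{rank}_t(\mathcal{A})=r$, $\mathcal{A}=\mathcal{Q}*_M\mathcal{D}*_M\mathcal{R}$ is an $M$-$\mathcal{QDR}$ decomposition of $\mathcal{A}$ if $\mathcal{Q}\in\mathbb{C}(x)^{m\times r\times p}$, $\mathcal{D}\in\mathbb{C}(x)^{r\times r\times p}$, $\mathcal{R}\in\mathbb{C}(x)^{r\times n\times p}$ satisfy $\tilde{\mathcal{Q}}(:,j,:)\ne\mathbf{0}$, $\tilde{\mathcal{R}}(i,:,:)\ne\mathbf{0}$, $\tilde{\mathcal{D}}(i,:,:)\ne\mathbf{0}$ and $\tilde{\mathcal{D}}(:,j,:)\ne\mathbf{0}$ for all $i,j=1,\ldots,r$. Range and null space of $\mathcal{A}\in\mathbb{C}(x)^{m\times n\times p}$: $\mathscr{R}(\mathcal{A})=\{\mathcal{A}*_M\mathcal{X}\mid \mathcal{X}\in\mathbb{C}(x)^{n\times 1\times p}\}$ and $\mathscr{N}(\mathcal{A})=\{\mathcal{X}\in\mathbb{C}(x)^{n\times 1\times p}\mid \mathcal{A}*_M\mathcal{X}=\mathcal{O}\}$. Outer inverse: for $\mathcal{A}\in\mathbb{C}(x)^{m\times n\times p}$, $\mathcal{A}^{(2)}_{\mathscr{R}(\mathcal{B}),\mathscr{N}(\mathcal{C})}$ is the (unique, if it exists) tensor $\mathcal{Z}\in\mathbb{C}(x)^{n\times m\times p}$ with $\mathcal{Z}*_M\mathcal{A}*_M\mathcal{Z}=\mathcal{Z}$,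 $\mathscr{R}(\mathcal{Z})=\mathscr{R}(\mathcal{B})$ and $\mathscr{N}(\mathcal{Z})=\mathscr{N}(\mathcal{C})$. *)

(* Defs.v *)
From mathcomp Require Import all_boot all_order all_algebra.
From mathcomp Require Import classical_sets reals.
From mathcomp Require Import complex.

Set Implicit Arguments.
Unset Strict Implicit.
Unset Printing Implicit Defensive.

Import GRing.Theory.

Local Open Scope ring_scope.
Local Open Scope classical_set_scope.

(* Since all realTypes are isomorphic to the real line, this is C(x). *)
Definition ratfun (T : realType) : fieldType := {fraction {poly complex T}}.

(* A tensor is the family of its frontal slices: A(i,j,k) is [A k i j]. *)
Definition tensor (F : fieldType) (m n p : nat) := {ffun 'I_p -> 'M[F]_(m, n)}.

Section MProduct.
Variables (F : fieldType) (p : nat).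
Implicit Types (M : 'M[F]_p) (m n q r : nat).

Definition mode3 M m n (A : tensor F m n p) : tensor F m n p :=
  [ffun k => \matrix_(i, j) \sum_(l < p) M k l * A l i j].

Definition lateral m n (A : tensor F m n p) (j : 'I_n) : tensor F m 1 p :=
  [ffun k => col j (A k)].

Definition horizontal m n (A : tensor F m n p) (i : 'I_m) : tensor F 1 n p :=
  [ffun k => row i (A k)].

(* Only meaningful for M \in unitmx; see mode3_tprod and tprod_uniq. *)
Definition tprod M m n q (A : tensor F m n p) (B : tensor F n q p)
    : tensor F m q p :=
  mode3 (invmx M) [ffun k => mode3 M A k *m mode3 M B k].

Definition tinvertible M n (A : tensor F n n p) : Prop :=
  forall k, mode3 M A k \in unitmx.

(* Only meaningful for M \in unitmx and A invertible; see mode3_tinv. *)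
Definition tinv M n (A : tensor F n n p) : tensor F n n p :=
  mode3 (invmx M) [ffun k => invmx (mode3 M A k)].

Definition multirank M m n (A : tensor F m n p) : {ffun 'I_p -> nat} :=
  [ffun k => \rank (mode3 M A k)].

Definition tubal_rank M m n (A : tensor F m n p) : nat :=
  (\max_(k < p) multirank M A k)%N.

Definition trange M m n (A : tensor F m n p) : set (tensor F m 1 p) :=
  [set Y | exists X : tensor F n 1 p, Y = tprod M A X].

Definition tnull M m n (A : tensor F m n p) : set (tensor F n 1 p) :=
  [set X | tprod M A X = 0].

Definition is_MQDR M m n r (A : tensor F m n p) (Q : tensor F m r p)
    (D : tensor F r r p) (R : tensor F r n p) : Prop :=
  [/\ tubal_rank M A = r,
      A = tprod M (tprod M Q D) R,
      forall j, lateral (mode3 M Q) j != 0,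
      forall i, horizontal (mode3 M R) i != 0
    & (forall i, horizontal (mode3 M D) i != 0) /\
      (forall j, lateral (mode3 M D) j != 0)].

(* [Z] is an outer inverse of [A] with range [U] and null space [V]. *)
Definition is_outer_inverse M m n (A : tensor F m n p)
    (U : set (tensor F n 1 p)) (V : set (tensor F m 1 p))
    (Z : tensor F n m p) : Prop :=
  [/\ tprod M (tprod M Z A) Z = Z, trange M Z = U & tnull M Z = V].

Lemma mode3_mode3 M N m n (A : tensor F m n p) :
  mode3 M (mode3 N A) = mode3 (M *m N) A.
Proof.
apply/ffunP => k; apply/matrixP => i j; rewrite !ffunE !mxE.
under eq_bigr => l _ do rewrite ffunE mxE big_distrr /=.
rewrite exchange_big /=; apply: eq_bigr => l _.
by rewrite mxE big_distrl /=; apply: eq_bigr => h _; rewrite mulrA.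
Qed.

Lemma mode3_1 m n (A : tensor F m n p) : mode3 1%:M A = A.
Proof.
apply/ffunP => k; apply/matrixP => i j; rewrite !ffunE !mxE.
rewrite (bigD1 k) //= mxE eqxx mul1r big1 ?addr0 // => l lk.
by rewrite mxE eq_sym (negPf lk) mul0r.
Qed.

Lemma mode3K M m n : M \in unitmx ->
  cancel (@mode3 M m n) (@mode3 (invmx M) m n).
Proof. by move=> uM A; rewrite mode3_mode3 mulVmx // mode3_1. Qed.

Lemma mode3VK M m n : M \in unitmx ->
  cancel (@mode3 (invmx M) m n) (@mode3 M m n).
Proof. by move=> uM A; rewrite mode3_mode3 mulmxV // mode3_1. Qed.

Lemma mode3_tprod M m n q (A : tensor F m n p) (B : tensor F n q p) k :
  M \in unitmx -> mode3 M (tprod M A B) k = mode3 M A k *m mode3 M B k.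
Proof. by move=> uM; rewrite mode3VK // ffunE. Qed.

Lemma tprod_uniq M m n q (A : tensor F m n p) (B : tensor F n q p)
    (C : tensor F m q p) :
  M \in unitmx -> (forall k, mode3 M C k = mode3 M A k *m mode3 M B k) ->
  C = tprod M A B.
Proof.
move=> uM eC; apply: (can_inj (mode3K uM)); apply/ffunP => k.
by rewrite mode3_tprod.
Qed.

Lemma mode3_tinv M n (A : tensor F n n p) k :
  M \in unitmx -> mode3 M (tinv M A) k = invmx (mode3 M A k).
Proof. by move=> uM; rewrite mode3VK // ffunE. Qed.

End MProduct.

Notation "A *_[ M ] B" := (tprod M A B)
  (at level 40, left associativity, format "A  *_[ M ]  B") : ring_scope.

(* Main.v *)
Require Import Defs.
From mathcomp Require Import all_boot all_order all_algebra.
From mathcomp Require Import classical_sets reals.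
From mathcomp Require Import complex.

(** The transform along [M] turns the M-product into a slicewise matrix
    product, so every claim reduces to linear algebra over a field on each
    transformed slice, where [W = Q D R] has rank [s].

    Since [s] is the inner dimension of the factorization, [W] having rank [s]
    forces the slices of [Q D] to be injective and those of [D R] to be
    surjective; the same holds of [Q] and [R] alone.  Composing with a
    surjective right factor keeps the range, and composing with an injective
    left factor keeps the null space ([trange_tprodl], [tnull_tprodr]); hence
    [W] has the range of [Q] and the null space of [R], and the two outer
    inverses of the statement are one and the same.

    The slices of [G = R A Q] are square of full rank, so [G] is invertible.
    Then [X = Q G^-1 R] is an outer inverse because the middle factor [R A Q] of
    [X A X] cancels one [G^-1]; it has the range of [Q] and the null space of
    [R] by the same two lemmas.  Finally, an outer inverse is determined by
    its range and null space ([outer_inverse_uniq]): when [Z1] and [Z2] share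
    both, [Z2 A Z1] equals [Z1] (range) and also [Z2] (null space). *)

Set Implicit Arguments.
Unset Strict Implicit.
Unset Printing Implicit Defensive.

Import GRing.Theory.

Local Open Scope ring_scope.

Section FactorRank.
Variables (F : fieldType) (m n s : nat).
Variables (Q : 'M[F]_(m, s)) (R : 'M[F]_(s, n)).
Hypothesis rankQR : \rank (Q *m R) = s.

(** The rank of a product is at most that of either factor, and here it
    reaches the inner dimension. *)
Lemma row_full_factor : row_full Q.
Proof.
by rewrite /row_full eqn_leq rank_leq_col -[X in (X <= _)%N]rankQR mxrankM_maxl.
Qed.

Lemma row_free_factor : row_free R.
Proof.
by rewrite /row_free eqn_leq rank_leq_row -[X in (X <= _)%N]rankQR mxrankM_maxr.
Qed.

End FactorRank.

Section MProductTheory.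
Variables (F : fieldType) (p : nat) (M : 'M[F]_p).
Hypothesis M_unit : M \in unitmx.

Lemma mode3_inj m n (A B : tensor F m n p) :
  (forall k, mode3 M A k = mode3 M B k) -> A = B.
Proof. by move=> eqAB; apply/(can_inj (mode3K M_unit))/ffunP. Qed.

Lemma multirankE m n (A : tensor F m n p) k :
  multirank M A k = \rank (mode3 M A k).
Proof. by rewrite ffunE. Qed.

Definition tensor_of_slices m n (S : 'I_p -> 'M[F]_(m, n)) : tensor F m n p :=
  mode3 (invmx M) [ffun k => S k].

Lemma mode3_of_slices m n (S : 'I_p -> 'M[F]_(m, n)) k :
  mode3 M (tensor_of_slices S) k = S k.
Proof. by rewrite mode3VK // ffunE. Qed.

Definition tid n : tensor F n n p := tensor_of_slices (fun=> 1%:M).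

Lemma mode3B m n (A B : tensor F m n p) k :
  mode3 M (A - B) k = mode3 M A k - mode3 M B k.
Proof.
apply/matrixP => i j; rewrite !ffunE !mxE -sumrB.
by apply: eq_bigr => l _; rewrite !ffunE !mxE mulrBr.
Qed.

Lemma mode3_0 m n k : mode3 M (0 : tensor F m n p) k = 0.
Proof. by rewrite -(subrr (0 : tensor F m n p)) mode3B subrr. Qed.

Lemma mode3_lateral m n (A : tensor F m n p) j k :
  mode3 M (lateral A j) k = col j (mode3 M A k).
Proof.
apply/matrixP => i h; rewrite !ffunE !mxE.
by apply: eq_bigr => l _; rewrite ffunE mxE.
Qed.

Lemma lateral_inj m n (A B : tensor F m n p) :
  (forall j, lateral A j = lateral B j) -> A = B.
Proof.
move=> eqAB; apply/ffunP => k; apply/matrixP => i j.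
by have /ffunP/(_ k)/matrixP/(_ i 0) := eqAB j; rewrite !ffunE !mxE.
Qed.

Lemma tprodA m n q r (A : tensor F m n p) (B : tensor F n q p)
    (C : tensor F q r p) : A *_[M] (B *_[M] C) = A *_[M] B *_[M] C.
Proof. by apply: mode3_inj => k; rewrite !mode3_tprod // mulmxA. Qed.

Lemma tprod1 m n (A : tensor F m n p) : A *_[M] tid n = A.
Proof.
by apply: mode3_inj => k; rewrite mode3_tprod // mode3_of_slices mulmx1.
Qed.

Lemma tprodBr m n q (A : tensor F m n p) (B C : tensor F n q p) :
  A *_[M] (B - C) = A *_[M] B - A *_[M] C.
Proof.
by apply: mode3_inj => k; rewrite mode3B !mode3_tprod // mode3B mulmxBr.
Qed.

Lemma tprod0 m n q (A : tensor F m n p) :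
  A *_[M] (0 : tensor F n q p) = 0.
Proof. by rewrite -(subrr (0 : tensor F n q p)) tprodBr subrr. Qed.

Lemma lateral_tprod m n q (A : tensor F m n p) (B : tensor F n q p) j :
  lateral (A *_[M] B) j = A *_[M] lateral B j.
Proof.
apply: mode3_inj => k.
by rewrite mode3_lateral !mode3_tprod // mode3_lateral !colE mulmxA.
Qed.

Lemma lateral0 m n j : lateral (0 : tensor F m n p) j = 0.
Proof. by apply/ffunP => k; apply/matrixP => i h; rewrite !ffunE !mxE. Qed.

Lemma tprodVt n (A : tensor F n n p) :
  tinvertible M A -> tinv M A *_[M] A = tid n.
Proof.
move=> uA; apply: mode3_inj => k.
by rewrite mode3_tprod // mode3_tinv // mode3_of_slices mulVmx.
Qed.

Lemma tinvertible_tinv n (A : tensor F n n p) :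
  tinvertible M A -> tinvertible M (tinv M A).
Proof. by move=> uA k; rewrite mode3_tinv // unitmx_inv. Qed.

(** Multiplication by [B] is onto, slicewise by the right inverse
    [pinvmx], so that the vectors [A B X] are all the vectors [A Y]. *)
Lemma trange_tprodl m n q (A : tensor F m n p) (B : tensor F n q p) :
  (forall k, row_free (mode3 M B k)) -> trange M (A *_[M] B) = trange M A.
Proof.
move=> freeB; apply/seteqP; split=> [_ [X ->]|_ [X ->]].
  by exists (B *_[M] X); rewrite tprodA.
exists (tensor_of_slices (fun k => pinvmx (mode3 M B k)) *_[M] X).
apply: mode3_inj => k.
by rewrite !mode3_tprod // mode3_of_slices -(mulmxA (mode3 M A k))
           (mulmxA (mode3 M B k)) mulmxVp // mul1mx.
Qed.

(** Multiplication by [A] is one-to-one, so that [A B X] vanishes only when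
    [B X] does. *)
Lemma tnull_tprodr m n q (A : tensor F m n p) (B : tensor F n q p) :
  (forall k, row_full (mode3 M A k)) -> tnull M (A *_[M] B) = tnull M B.
Proof.
move=> fullA; rewrite /tnull; apply/seteqP; split=> X /= eX0;
  last by rewrite -tprodA eX0 tprod0.
apply: mode3_inj => k; apply: (row_full_inj (fullA k)).
by rewrite -mode3_tprod // tprodA eX0 !mode3_0 mulmx0.
Qed.

(** [Z1] and [Z2] both equal [Z2 A Z1].  On the one hand [Z2 A] is the
    identity on the range of [Z2], which contains the lateral slices of [Z1];
    on the other hand [1 - A Z1] has its lateral slices in the null space of
    [Z1], hence is killed by [Z2]. *)
Lemma outer_inverse_uniq m n (A : tensor F m n p) U V (Z1 Z2 : tensor F n m p) :
  is_outer_inverse M A U V Z1 -> is_outer_inverse M A U V Z2 -> Z1 = Z2.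
Proof.
move=> [Z1AZ1 rangeZ1 nullZ1] [Z2AZ2 rangeZ2 nullZ2].
have <- : Z2 *_[M] A *_[M] Z1 = Z1.
  apply: lateral_inj => j; rewrite lateral_tprod.
  have : trange M Z2 (lateral Z1 j).
    by rewrite rangeZ2 -rangeZ1; exists (lateral (tid m) j);
       rewrite -lateral_tprod tprod1.
  by move=> [Y ->]; rewrite tprodA Z2AZ2.
apply/esym/subr0_eq; rewrite -tprodA -{1}(tprod1 Z2) -tprodBr.
apply: lateral_inj => j; rewrite lateral_tprod lateral0.
suff : tnull M Z2 (lateral (tid m - A *_[M] Z1) j) by [].
by rewrite nullZ2 -nullZ1 /tnull /= -lateral_tprod tprodBr tprod1 tprodA Z1AZ1
           subrr lateral0.
Qed.

(** The factor [R A Q] in the middle of [X A X] cancels one of the two inverses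
    around it; the outer factors alone decide the range and the null space. *)
Lemma outer_inverse_of_factors m n s (A : tensor F m n p)
    (Q : tensor F n s p) (R : tensor F s m p) :
    (forall k, row_full (mode3 M Q k)) -> (forall k, row_free (mode3 M R k)) ->
    tinvertible M (R *_[M] A *_[M] Q) ->
  is_outer_inverse M A (trange M Q) (tnull M R)
    (Q *_[M] tinv M (R *_[M] A *_[M] Q) *_[M] R).
Proof.
set G := R *_[M] A *_[M] Q => fullQ freeR uG.
have uGV := tinvertible_tinv uG.
split.
- transitivity (Q *_[M] (tinv M G *_[M] G) *_[M] tinv M G *_[M] R).
    by rewrite /G !tprodA.
  by rewrite tprodVt // tprod1.
- rewrite trange_tprodl // trange_tprodl // => k.
  by rewrite row_free_unit uGV.
- rewrite -tprodA tnull_tprodr // tnull_tprodr // => k.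
  by rewrite row_full_unit uGV.
Qed.

(** In [Q (D R)] and [(Q D) R] alike the inner dimension is the rank, so [Q]
    and [Q D] are injective while [R] and [D R] are surjective.  Thus [W] has the
    range of [Q] and the null space of [R], and both pairs of conditions define
    the same outer inverse. *)
Lemma outer_inverse_of_full_rank_factorization m n s (A : tensor F m n p)
    (W : tensor F n m p) (Q : tensor F n s p) (D : tensor F s s p)
    (R : tensor F s m p) (X := Q *_[M] tinv M (R *_[M] A *_[M] Q) *_[M] R) :
    W = Q *_[M] D *_[M] R -> multirank M W = [ffun=> s] ->
    multirank M (R *_[M] A *_[M] Q) = [ffun=> s] ->
  [/\ tinvertible M (R *_[M] A *_[M] Q),
      unique (is_outer_inverse M A (trange M W) (tnull M W)) X
    & unique (is_outer_inverse M A (trange M Q) (tnull M R)) X].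
Proof.
move=> defW rankW rankRAQ.
have rank_slice k : \rank (mode3 M Q k *m mode3 M D k *m mode3 M R k) = s.
  by have /ffunP/(_ k) := rankW;
     rewrite multirankE [RHS]ffunE defW !mode3_tprod.
have fullQD k : row_full (mode3 M (Q *_[M] D) k).
  by rewrite mode3_tprod //; apply: row_full_factor (rank_slice k).
have freeR k : row_free (mode3 M R k) by apply: row_free_factor (rank_slice k).
have rank_slice' k : \rank (mode3 M Q k *m (mode3 M D k *m mode3 M R k)) = s.
  by rewrite mulmxA.
have fullQ k : row_full (mode3 M Q k) by apply: row_full_factor (rank_slice' k).
have freeDR k : row_free (mode3 M (D *_[M] R) k).
  by rewrite mode3_tprod //; apply: row_free_factor (rank_slice' k).
have uG : tinvertible M (R *_[M] A *_[M] Q).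
  move=> k; rewrite -row_free_unit /row_free.
  by move: rankRAQ => /ffunP/(_ k); rewrite multirankE [RHS]ffunE => ->.
have rangeW : trange M W = trange M Q by rewrite defW -tprodA trange_tprodl.
have nullW : tnull M W = tnull M R by rewrite defW tnull_tprodr.
have uniqX : unique (is_outer_inverse M A (trange M Q) (tnull M R)) X.
  split; first exact: outer_inverse_of_factors.
  by move=> Z; apply: outer_inverse_uniq => //; apply: outer_inverse_of_factors.
by split=> //; rewrite rangeW nullW.
Qed.

End MProductTheory.

Theorem theorem3p3 (T : realType) (m n p r s : nat)
    (M : 'M[ratfun T]_p)
    (A : tensor (ratfun T) m n p) (W : tensor (ratfun T) n m p)
    (Q : tensor (ratfun T) n s p) (D : tensor (ratfun T) s s p)
    (R : tensor (ratfun T) s m p)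
    (M_unit : M \in unitmx)
    (rankA : multirank M A = [ffun=> r])
    (rankW : multirank M W = [ffun=> s])
    (le_sr : (s <= r)%N)
    (QDR : is_MQDR M W Q D R)
    (rankRAQ : multirank M (R *_[M] A *_[M] Q) = multirank M W)
    (exZ : exists Z, is_outer_inverse M A (trange M W) (tnull M W) Z) :
  tinvertible M (R *_[M] A *_[M] Q) /\
  let X := Q *_[M] tinv M (R *_[M] A *_[M] Q) *_[M] R in
  unique (is_outer_inverse M A (trange M W) (tnull M W)) X /\
  unique (is_outer_inverse M A (trange M Q) (tnull M R)) X.
Proof.
case: QDR => _ defW _ _ _; rewrite rankW in rankRAQ.
have [uG uniqW uniqQR] :=
  outer_inverse_of_full_rank_factorization M_unit defW rankW rankRAQ.
by split.
Qed.
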